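(* As formal power series in $q$ with coefficients polynomials in the free parameters $a,b,c$, \[ \sum_{i=0}^{\infty}\frac{a^iq^{T_i}}{(q;q)_i}\left(-\frac{c}{a}q;q\right)_i(-bq^{i+1};q)_\infty=\sum_{t,\ell,j\ge 0}\frac{a^tb^{\ell}c^jq^{T_{t+\ell+j}+T_j}}{(q;q)_t(q;q)_\ell(q;q)_j}. \]
   Context: $T_k=k(k+1)/2$. For $n\ge 0$, $(x;q)_n=\prod_{j=0}^{n-1}(1-xq^j)$ and $(x;q)_\infty=\prod_{j\ge0}(1-xq^j)$. Note $a^i(-\tfrac{c}{a}q;q)_i$ is a polynomial in $a,c$. *)

(* Defs.v *)
From HB Require Import structures.
From mathcomp Require Import all_boot all_order all_algebra.
From mathcomp Require Import boolp.
From mathcomp Require Export mpoly.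

Set Implicit Arguments.
Unset Strict Implicit.
Unset Printing Implicit Defensive.

Import GRing.Theory.
Local Open Scope ring_scope.

Record fps (R : Type) : Type := Fps { fcoef : nat -> R }.

Notation "{ 'fps' R }" := (fps R) (format "{ 'fps'  R }") : type_scope.
Notation "f ``_ n" := (fcoef f n)
  (at level 3, n at level 2, left associativity, format "f ``_ n") : ring_scope.

HB.instance Definition _ (R : Type) := gen_eqMixin {fps R}.
HB.instance Definition _ (R : Type) := gen_choiceMixin {fps R}.

Lemma fpsP (R : Type) (f g : {fps R}) : (forall n, f``_n = g``_n) <-> f = g.
Proof.
split=> [|->//]; case: f g => [f] [g] /= fg.
by congr Fps; apply/funext.
Qed.

Section FpsRing.
Variable R : comNzRingType.
Implicit Types f g h : {fps R}.

Definition fps_zero : {fps R} := Fps (fun=> 0).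
Definition fps_opp f : {fps R} := Fps (fun n => - f``_n).
Definition fps_add f g : {fps R} := Fps (fun n => f``_n + g``_n).

Fact fps_addA : associative fps_add.
Proof. by move=> f g h; apply/fpsP => n /=; rewrite addrA. Qed.
Fact fps_addC : commutative fps_add.
Proof. by move=> f g; apply/fpsP => n /=; rewrite addrC. Qed.
Fact fps_add0 : left_id fps_zero fps_add.
Proof. by move=> f; apply/fpsP => n /=; rewrite add0r. Qed.
Fact fps_addN : left_inverse fps_zero fps_opp fps_add.
Proof. by move=> f; apply/fpsP => n /=; rewrite addNr. Qed.

HB.instance Definition _ :=
  GRing.isZmodule.Build {fps R} fps_addA fps_addC fps_add0 fps_addN.

Definition fps_one : {fps R} := Fps (fun n => (n == 0)%:R).
Definition fps_mul f g : {fps R} :=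
  Fps (fun n => \sum_(i < n.+1) f``_i * g``_(n - i)).

Definition fps_trunc (N : nat) f : {poly R} := \poly_(i < N) f``_i.

Lemma fps_trunc_mul (N : nat) f g n : (n < N)%N ->
  (fps_trunc N f * fps_trunc N g)`_n = (fps_mul f g)``_n.
Proof.
move=> ltnN; rewrite coefM; apply: eq_bigr => i _.
rewrite !coef_poly (leq_ltn_trans (leq_subr _ _) ltnN).
by rewrite (leq_ltn_trans _ ltnN) // -ltnS.
Qed.

Fact fps_mulC : commutative fps_mul.
Proof.
by move=> f g; apply/fpsP => n; rewrite -!(@fps_trunc_mul n.+1) // mulrC.
Qed.

Fact fps_mulA : associative fps_mul.
Proof.
move=> f g h; apply/fpsP => n.
transitivity ((fps_trunc n.+1 f * (fps_trunc n.+1 g * fps_trunc n.+1 h))`_n).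
  rewrite coefM; apply: eq_bigr => i _.
  rewrite coef_poly ltn_ord; congr (_ * _).
  by rewrite fps_trunc_mul // ltnS leq_subr.
rewrite mulrA coefM; apply: eq_bigr => i _.
by rewrite coef_poly ltnS leq_subr fps_trunc_mul.
Qed.

Fact fps_mul1 : left_id fps_one fps_mul.
Proof.
move=> f; apply/fpsP => n /=.
rewrite big_ord_recl /= mul1r subn0 big1 ?addr0 // => i _.
by rewrite mul0r.
Qed.

Fact fps_mulD : left_distributive fps_mul fps_add.
Proof.
move=> f g h; apply/fpsP => n /=; rewrite -big_split.
by apply: eq_bigr => i _; rewrite mulrDl.
Qed.

Fact fps_one_neq0 : fps_one != 0.
Proof.
by apply/eqP => /(congr1 (fun f => f``_0)) /= /eqP; rewrite oner_eq0.
Qed.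

HB.instance Definition _ := GRing.Zmodule_isComNzRing.Build {fps R}
  fps_mulA fps_mulC fps_mul1 fps_mulD fps_one_neq0.

Lemma fcoef0 n : (0 : {fps R})``_n = 0. Proof. by []. Qed.
Lemma fcoef1 n : (1 : {fps R})``_n = (n == 0)%:R. Proof. by []. Qed.
Lemma fcoefD f g n : (f + g)``_n = f``_n + g``_n. Proof. by []. Qed.
Lemma fcoefN f n : (- f)``_n = - f``_n. Proof. by []. Qed.
Lemma fcoefB f g n : (f - g)``_n = f``_n - g``_n. Proof. by []. Qed.
Lemma fcoefM f g n :
  (f * g)``_n = \sum_(i < n.+1) f``_i * g``_(n - i).
Proof. by []. Qed.
Lemma fcoef_sum (I : Type) (r : seq I) (P : pred I) (F : I -> {fps R}) n :
  (\sum_(i <- r | P i) F i)``_n = \sum_(i <- r | P i) (F i)``_n.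
Proof. exact: (big_morph (fun f => f``_n) (fun f g => fcoefD f g n)). Qed.

Definition fpsC (x : R) : {fps R} := Fps (fun n => x *+ (n == 0)).
Definition fpsX : {fps R} := Fps (fun n => (n == 1)%:R).

Fact fpsC_zmod : zmod_morphism fpsC.
Proof. by move=> x y; apply/fpsP => n /=; rewrite mulrnBl. Qed.
Fact fpsC_monoid : monoid_morphism fpsC.
Proof.
split=> [|x y]; apply/fpsP => n //; rewrite fcoefM big_ord_recl /= subn0.
rewrite big1 ?addr0 => [|i _]; last by rewrite mul0r.
by case: eqP => _; rewrite !(mulr1n, mulr0n, mulr0).
Qed.
HB.instance Definition _ := GRing.isZmodMorphism.Build R {fps R} fpsC fpsC_zmod.
HB.instance Definition _ :=
  GRing.isMonoidMorphism.Build R {fps R} fpsC fpsC_monoid.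

Lemma fcoefCM x f n : (fpsC x * f)``_n = x * f``_n.
Proof.
rewrite fcoefM big_ord_recl /= subn0 big1 ?addr0 // => i _.
by rewrite mul0r.
Qed.

Lemma fcoefM_low (m k : nat) f g : (forall n, (n < m)%N -> f``_n = 0) ->
  (forall n, (n < k)%N -> g``_n = 0) ->
  forall n, (n < m + k)%N -> (f * g)``_n = 0.
Proof.
move=> f0 g0 n ltn_mk; rewrite fcoefM big1 // => i _.
case: (ltnP i m) => [/f0->|le_mi]; first by rewrite mul0r.
have lt_nik : (n < i + k)%N by rewrite (leq_trans ltn_mk) ?leq_add2r.
by rewrite g0 ?mulr0 // -(ltn_add2l i) subnKC // -ltnS.
Qed.

Lemma fcoefX_low f (m n : nat) : f``_0 = 0 -> (n < m)%N -> (f ^+ m)``_n = 0.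
Proof.
move=> f0; elim: m n => // m IHm n ltnm; rewrite exprS.
by apply: (@fcoefM_low 1 m) => // -[].
Qed.

End FpsRing.

Arguments fpsX {R}.
(* Otherwise [/=] unfolds the ring operations inside coefficients. *)
Arguments fcoef : simpl never.

Section FpsUnit.
Variable R : comUnitRingType.
Implicit Types f g h : {fps R}.

Definition fps_unit : pred {fps R} := fun f => f``_0 \is a GRing.unit.

(* With [c = f``_0 ^-1] and [u = 1 - c f], which has zero constant term, the
   inverse is [c * (1 + u + u^2 + ...)], and [u ^+ k] does not contribute to
   the coefficient of index [n] when [n < k]. *)
Definition fps_inv f : {fps R} :=
  if f``_0 \is a GRing.unit then
    let c := fpsC (f``_0)^-1 in
    Fps (fun n => (c * \sum_(k < n.+1) (1 - c * f) ^+ k)``_n)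
  else f.

Fact fps_mulVf : {in fps_unit, left_inverse 1 fps_inv *%R}.
Proof.
move=> f; rewrite unfold_in /fps_unit => fU; rewrite /fps_inv fU.
set c := fpsC _; set u := 1 - c * f.
have u0 : u``_0 = 0 by rewrite /u fcoefB fcoefCM mulVr ?subrr.
apply/fpsP => n.
transitivity ((c * (\sum_(k < n.+1) u ^+ k) * f)``_n).
  rewrite !fcoefM; apply: eq_bigr => i _; congr (_ * _).
  rewrite [LHS](_ : _ = (c * \sum_(k < i.+1) u ^+ k)``_i) //.
  rewrite !fcoefCM; congr (_ * _); rewrite !fcoef_sum.
  rewrite (big_ord_widen n.+1 (fun k => (u ^+ k)``_i)) // big_mkcond.
  apply: eq_bigr => k _; case: ltnP => // ltik.
  by rewrite fcoefX_low.
rewrite mulrAC.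
have -> : c * f = 1 - u by rewrite /u opprB addrC subrK.
rewrite -[1 - u]opprB mulNr -subrX1 fcoefN fcoefB.
by rewrite fcoefX_low // sub0r opprK.
Qed.

Fact fps_unitPl f g : g * f = 1 -> fps_unit f.
Proof.
move=> /(congr1 (fun h => h``_0)); rewrite fcoefM big_ord1 /= => gf1.
by apply/unitrP; exists g``_0; rewrite [f``_0 * _]mulrC gf1.
Qed.

Fact fps_inv_out : {in [predC fps_unit], fps_inv =1 id}.
Proof.
move=> f fNU; rewrite /fps_inv.
by have /negPf -> : f``_0 \isn't a GRing.unit by [].
Qed.

HB.instance Definition _ := GRing.ComNzRing_hasMulInverse.Build {fps R}
  fps_mulVf fps_unitPl fps_inv_out.

Lemma fps_unitE f : (f \is a GRing.unit) = (f``_0 \is a GRing.unit).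
Proof. by []. Qed.

End FpsUnit.

Definition map_fps (R S : Type) (phi : R -> S) (f : {fps R}) : {fps S} :=
  Fps (fun n => phi f``_n).

(* The family [u] is summable with sum [s]: for each [n] only finitely many
   terms [u i] have a nonzero coefficient of index [n], and the coefficient of
   the sum is the (finite) sum of those coefficients. *)
Definition fps_has_sum (R : comNzRingType) (I : eqType)
    (u : I -> {fps R}) (s : {fps R}) : Prop :=
  forall n, exists J : seq I,
    [/\ uniq J, forall i, (u i)``_n != 0 -> i \in J
      & s``_n = \sum_(i <- J) (u i)``_n].

Lemma fps_has_sum_uniq (R : comNzRingType) (I : eqType)
    (u : I -> {fps R}) (s s' : {fps R}) :
  fps_has_sum u s -> fps_has_sum u s' -> s = s'.
Proof.
move=> us us'; apply/fpsP => n.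
have [J [uJ supJ ->]] := us n; have [J' [uJ' supJ' ->]] := us' n.
pose A (K : seq I) := [seq i <- K | (u i)``_n != 0].
have sumA K : \sum_(i <- K) (u i)``_n = \sum_(i <- A K) (u i)``_n.
  rewrite big_filter [RHS]big_mkcond; apply: eq_bigr => i _.
  by case: eqP.
rewrite sumA [RHS]sumA; apply: perm_big; apply: uniq_perm; rewrite ?filter_uniq // => i.
rewrite !mem_filter; case: (boolP (_ != 0)) => //= nz.
by rewrite supJ // supJ'.
Qed.

Definition qpoch (R : comNzRingType) (x : {fps R}) (n : nat) : {fps R} :=
  \prod_(0 <= j < n) (1 - x * fpsX ^+ j).

(* The factors with [n < j] are [1] up to index [n], so the coefficient of
   index [n] of the infinite product is that of [qpoch x n.+1]; see
   [qpoch_inf_lim]. *)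
Definition qpoch_inf (R : comNzRingType) (x : {fps R}) : {fps R} :=
  Fps (fun n => (qpoch x n.+1)``_n).

Lemma fcoefXq_low (R : comNzRingType) (x : {fps R}) (j n : nat) :
  (n < j)%N -> (x * fpsX ^+ j)``_n = 0.
Proof.
move=> ltnj; apply: (@fcoefM_low _ 0 j) => // k ltkj.
by apply: fcoefX_low.
Qed.

Lemma qpoch_inf_lim (R : comNzRingType) (x : {fps R}) (n m : nat) :
  (n < m)%N -> (qpoch x m)``_n = (qpoch_inf x)``_n.
Proof.
elim: m => // m IHm; rewrite ltnS leq_eqVlt => /orP[/eqP->//|ltnm].
rewrite -IHm // /qpoch big_nat_recr //= mulrBr mulr1 fcoefB mulrA.
by rewrite fcoefXq_low ?subr0.
Qed.

Lemma qpoch_unit (R : comUnitRingType) (n : nat) :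
  qpoch (fpsX : {fps R}) n \is a GRing.unit.
Proof.
rewrite /qpoch rpred_prod // => j _.
by rewrite fps_unitE fcoefB -exprS fcoefX_low // subr0 fcoef1 unitr1.
Qed.

Definition Tri (k : nat) : nat := (k * (k + 1)) %/ 2.

(* Main.v *)
(* By the homogeneous q-binomial theorem, multiplying out
     a^i (-c q/a; q)_i = \prod_(1 <= k <= i) (a + c q^k)
   turns the [i]-th term of the left-hand side into a sum over [t + j = i].
   The same theorem with [a = 1], as the number of factors grows, gives
   Euler's expansion of [(- b q^(i+1); q)_oo] in powers of [b].  The exponents
   then match because [Tri (m + l) = Tri m + Tri l + m l]. *)

Require Import Defs.
From HB Require Import structures.
From mathcomp Require Import all_boot all_order all_algebra.
From mathcomp Require Import mpoly.
From mathcomp Require Import zify ring.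

Set Implicit Arguments.
Unset Strict Implicit.
Unset Printing Implicit Defensive.

Import GRing.Theory.
Local Open Scope ring_scope.

(** * Triangular numbers and triangular sums *)

Lemma TriS n : Tri n.+1 = (Tri n + n.+1)%N.
Proof.
rewrite /Tri !addn1 addnC -divnMDl //; congr (_ %/ 2)%N.
by rewrite [(n * _)%N]mulnC -mulnDr add2n.
Qed.

Lemma TriD m n : Tri (m + n) = (Tri m + Tri n + m * n)%N.
Proof.
elim: n => [|n IHn]; first by rewrite muln0 !addn0.
by rewrite addnS !TriS IHn mulnS; lia.
Qed.

Lemma leq_Tri n : (n <= Tri n)%N.
Proof. by case: n => // n; rewrite TriS leq_addl. Qed.

(** Since [G] vanishes off the triangle [t + j < N], the triangle can be completed to a square. *)
Lemma triangular_sum (V : nmodType) (G : nat -> nat -> V) N :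
  (forall t j, (N <= t + j)%N -> G t j = 0) ->
  \sum_(i < N) \sum_(j < i.+1) G (i - j)%N j = \sum_(t < N) \sum_(j < N) G t j.
Proof.
move=> G0; rewrite [RHS]exchange_big /=.
transitivity (\sum_(i < N) \sum_(j < N | (j < i.+1)%N) G (i - j)%N j).
  apply: eq_bigr => i _.
  exact: (big_ord_widen _ (fun j => G (i - j)%N j)).
rewrite (exchange_big_dep xpredT) //=; apply: eq_bigr => j _.
(* For fixed [j], the index [i] runs over [j <= i < N]; shift to [t = i - j]. *)
rewrite -(big_geq_mkord _ _ xpredT (fun i => G (i - j)%N j)).
rewrite -{1}[nat_of_ord j]add0n big_addn big_mkord.
transitivity (\sum_(t < N - j) G t j); first by apply: eq_bigr => t _; rewrite addnK.
rewrite (big_ord_widen N (G^~ j)) ?leq_subr // big_mkcond.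
by apply: eq_bigr => t _; case: ltnP => //; rewrite leq_subLR addnC => /G0.
Qed.

(** * Change of coefficient ring *)

Section MapFps.
Variables (R S : comNzRingType) (phi : {rmorphism R -> S}).

Fact map_fps_zmod : zmod_morphism (map_fps phi).
Proof. by move=> f g; apply/fpsP => n; apply: rmorphB. Qed.

Fact map_fps_monoid : monoid_morphism (map_fps phi).
Proof.
split=> [|f g]; apply/fpsP => n; first exact: rmorph_nat.
rewrite fcoefM [LHS]rmorph_sum; apply: eq_bigr => i _.
exact: rmorphM.
Qed.

HB.instance Definition _ :=
  GRing.isZmodMorphism.Build {fps R} {fps S} (map_fps phi) map_fps_zmod.
HB.instance Definition _ :=
  GRing.isMonoidMorphism.Build {fps R} {fps S} (map_fps phi) map_fps_monoid.

Lemma map_fpsC x : map_fps phi (fpsC x) = fpsC (phi x).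
Proof. by apply/fpsP => n; apply: rmorphMn. Qed.

Lemma map_fpsX : map_fps phi fpsX = fpsX.
Proof. by apply/fpsP => n; apply: rmorph_nat. Qed.

Lemma map_qpoch x n : map_fps phi (qpoch x n) = qpoch (map_fps phi x) n.
Proof.
rewrite rmorph_prod; apply: eq_bigr => j _.
by rewrite rmorphB rmorph1 rmorphM rmorphXn /= map_fpsX.
Qed.

End MapFps.

Section FpsCoef.
Variable R : comNzRingType.
Implicit Types f g h : {fps R}.

Lemma eq_fcoefM f g h n :
  (forall k, (k <= n)%N -> f``_k = g``_k) -> (h * f)``_n = (h * g)``_n.
Proof.
by move=> fg; rewrite !fcoefM; apply: eq_bigr => i _; rewrite fg ?leq_subr.
Qed.

Lemma fcoefMXn_low f g m n : (n < m)%N -> (f * fpsX ^+ m * g)``_n = 0.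
Proof. by move=> ltnm; rewrite mulrAC fcoefXq_low. Qed.

End FpsCoef.

(** * Finite and infinite q-binomial expansions *)

Section QSeries.
Variable R : comUnitRingType.
Implicit Types a b c x : {fps R}.
Local Notation q := (fpsX : {fps R}).
Local Notation "[ 'qf' n ]" := (qpoch q n) (format "[ 'qf'  n ]").

Lemma qpoch0 x : qpoch x 0 = 1.
Proof. exact: big_geq. Qed.

Lemma qpochXS n : [qf n.+1] = [qf n] * (1 - q ^+ n.+1).
Proof. by rewrite /qpoch big_nat_recr //= -exprS. Qed.

Lemma qpochXSV n : (1 - q ^+ n.+1) / [qf n.+1] = [qf n]^-1.
Proof.
apply: (can_inj (mulrK (qpoch_unit R n.+1))).
by rewrite mulrVK ?qpoch_unit // qpochXS mulKr ?qpoch_unit.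
Qed.

(** The Gaussian binomial coefficient is split as [[qf m]] over [[qf j]] and [[qf m - j]], so the
    sum is a convolution of two sequences with the first-order recurrences [ES] and [A_S]; these
    drive the induction on [m]. *)
Lemma qbinomial a c m :
  \prod_(k < m) (a + c * q ^+ k.+1) =
  [qf m] * \sum_(j < m.+1)
    (c ^+ j * q ^+ Tri j / [qf j]) * (a ^+ (m - j) / [qf m - j]).
Proof.
pose E j := c ^+ j * q ^+ Tri j / [qf j].
pose A k := a ^+ k / [qf k].
have ES j : (1 - q ^+ j.+1) * E j.+1 = c * q ^+ j.+1 * E j.
  by rewrite /E mulrCA qpochXSV TriS exprD exprS; ring.
have A_S k : (1 - q ^+ k.+1) * A k.+1 = a * A k.
  by rewrite /A mulrCA qpochXSV exprS mulrA.
rewrite -[RHS]/([qf m] * \sum_(j < m.+1) E j * A (m - j)%N).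
elim: m => [|m IHm].
  by rewrite big_ord0 big_ord1 /E /A /= subnn (_ : Tri 0 = 0%N) // !expr0 !qpoch0 !invr1 !mulr1.
rewrite big_ord_recr IHm /= qpochXS -!mulrA; congr (_ * _).
(* Here [m.+1 = j + (m.+1 - j)] and
   [1 - q^(j + k) = (1 - q^k) + q^k (1 - q^j)]. *)
have split_q (j : 'I_m.+2) : (1 - q ^+ m.+1) * (E j * A (m.+1 - j)%N) =
    E j * ((1 - q ^+ (m.+1 - j)) * A (m.+1 - j)%N) +
    q ^+ (m.+1 - j) * ((1 - q ^+ j) * E j) * A (m.+1 - j)%N.
  have -> : q ^+ m.+1 = q ^+ j * q ^+ (m.+1 - j) by rewrite -exprD subnKC // -ltnS.
  ring.
rewrite big_distrr /= (eq_bigr _ (fun j _ => split_q j)) big_split /=.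
(* By [A_S] the first half gives the summand [a] of the new factor, by [ES] the second gives
   [c * q ^+ m.+1]; the boundary terms [j = m.+1] and [j = 0] vanish. *)
rewrite mulrDr; congr (_ + _).
  rewrite [RHS]big_ord_recr /= subnn expr0 subrr mul0r mulr0 addr0.
  rewrite big_distrl; apply: eq_bigr => j _ /=.
  by rewrite subSn -1?ltnS // A_S; ring.
rewrite [RHS]big_ord_recl /= expr0 subrr mul0r mulr0 mul0r add0r.
rewrite big_distrl; apply: eq_bigr => j _ /=.
rewrite /bump /= add1n subSS ES.
have -> : q ^+ m.+1 = q ^+ (m - j) * q ^+ j.+1 by rewrite -exprD addnS subnK // -ltnS.
ring.
Qed.

Lemma qpoch_prod a c m : a \is a GRing.unit ->
  a ^+ m * qpoch (- (c / a) * q) m = \prod_(k < m) (a + c * q ^+ k.+1).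
Proof.
move=> aU; rewrite /qpoch big_mkord -[X in _ ^+ X * _](card_ord m) -prodr_const.
rewrite -big_split; apply: eq_bigr => k _ /=.
by rewrite -mulrA -exprS mulNr opprK mulrDr mulr1 mulrA mulrCA divrr ?mulr1.
Qed.

(** Euler's expansion, cut at [N]: a term with [N <= l] starts at [q ^+ Tri l], beyond index [n]. *)
Lemma fcoef_qpoch_inf x n N : (n < N)%N ->
  (qpoch_inf (- x * q))``_n =
  (\sum_(l < N) x ^+ l * q ^+ Tri l / [qf l])``_n.
Proof.
(* With [N + n] factors, [[qf N + n - l]] still has more than [n] factors for every [l < N]. *)
move=> ltnN; rewrite -(@qpoch_inf_lim _ _ _ (N + n)%N) ?ltn_addr //.
have -> : qpoch (- x * q) (N + n) = \prod_(k < N + n) (1 + x * q ^+ k.+1).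
  by rewrite -qpoch_prod ?unitr1 // expr1n mul1r divr1.
rewrite qbinomial big_distrr /= !fcoef_sum -addnS big_split_ord /=.
rewrite [X in _ + X]big1 ?addr0 => [|l _]; last first.
  rewrite mulrCA -!mulrA mulrA fcoefMXn_low //.
  by rewrite (leq_trans _ (leq_Tri _)) // ltn_addr.
apply: eq_bigr => l _; rewrite expr1n mul1r mulrCA -[X in _ = X``_n]mulr1.
apply: eq_fcoefM => k lekn.
(* Up to index [n], [qf N + n] and [qf N + n - l] both agree with the infinite
   product, so their quotient is [1]. *)
have ltk : (k < N + n - l)%N.
  by rewrite ltn_subRL addnC (leq_ltn_trans (leq_add lekn (leqnn l))) // addnC ltn_add2r.
rewrite -(divrr (qpoch_unit R (N + n - l))) ![_ / _]mulrC.
apply: eq_fcoefM => i leik.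
have lti := leq_ltn_trans leik ltk.
by rewrite !qpoch_inf_lim // (leq_trans lti) ?leq_subr.
Qed.

(** * The common value of both sums *)

Definition triple_term a b c (x : nat * nat * nat) : {fps R} :=
  let: (t, l, j) := x in
  a ^+ t * b ^+ l * c ^+ j * q ^+ (Tri (t + l + j) + Tri j)
  / ([qf t] * [qf l] * [qf j]).

Definition triple_box n : seq (nat * nat * nat) :=
  [seq (tl, j) | tl <- [seq (t, l) | t <- iota 0 n, l <- iota 0 n],
                 j <- iota 0 n].

(** The box suffices at index [n]: the power of [q] in a term is at least [t + l + j]. No division
    by a parameter occurs, so this also makes sense over polynomials. *)
Definition triple_series a b c : {fps R} :=
  Fps (fun n => \sum_(x <- triple_box n.+1) (triple_term a b c x)``_n).

Lemma fcoef_triple_term a b c t l j n : (n < t + l + j)%N ->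
  (triple_term a b c (t, l, j))``_n = 0.
Proof.
move=> ltn; apply: fcoefMXn_low.
by rewrite (leq_trans ltn) // (leq_trans (leq_Tri _)) ?leq_addr.
Qed.

Lemma has_sum_triple a b c :
  fps_has_sum (triple_term a b c) (triple_series a b c).
Proof.
move=> n; exists (triple_box n.+1); split=> //.
  by do 2?[apply: allpairs_uniq; rewrite ?iota_uniq //] => [] [? ?] [? ?].
move=> [[t l] j] nz; have le_n : (t + l + j <= n)%N.
  by rewrite leqNgt; apply: contra nz => /fcoef_triple_term->.
apply: allpairs_f; first apply: allpairs_f; rewrite mem_iota ltnS (leq_trans _ le_n) //.
- by rewrite -addnA leq_addr.
- by rewrite addnAC leq_addl.
- by rewrite leq_addl.
Qed.

Definition single_term a b c (i : nat) : {fps R} :=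
  a ^+ i * q ^+ Tri i / [qf i]
  * qpoch (- (c / a) * q) i * qpoch_inf (- b * q ^+ i.+1).

Lemma fcoef_single_term a b c i n N : a \is a GRing.unit -> (n < N)%N ->
  (single_term a b c i)``_n =
  \sum_(j < i.+1) \sum_(l < N) (triple_term a b c ((i - j)%N, val l, val j))``_n.
Proof.
move=> aU ltnN; rewrite /single_term.
(* Euler's expansion is applied with [x = b * q ^+ i]. *)
have -> : - b * q ^+ i.+1 = - (b * q ^+ i) * q by rewrite exprSr mulrA mulNr.
rewrite (eq_fcoefM (g := \sum_(l < N) (b * q ^+ i) ^+ l * q ^+ Tri l / [qf l])); last first.
  by move=> k lekn; rewrite (@fcoef_qpoch_inf _ _ N) // (leq_ltn_trans lekn).
have -> : a ^+ i * q ^+ Tri i / [qf i] * qpoch (- (c / a) * q) i =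
    q ^+ Tri i / [qf i] * (a ^+ i * qpoch (- (c / a) * q) i) by ring.
rewrite qpoch_prod // qbinomial mulrA mulrVK ?qpoch_unit //.
rewrite -mulrA big_distrl big_distrr /= fcoef_sum.
apply: eq_bigr => j _; rewrite mulrA big_distrr /= fcoef_sum.
apply: eq_bigr => l _; congr (_ ``_ n).
have leji : (j <= i)%N by rewrite -ltnS.
(* With [t = i - j], [TriD] splits [Tri (i + l)]; its cross term [i * l] is the exponent coming from
   [(b * q ^+ i) ^+ l]. *)
rewrite /triple_term -addnA [(l + j)%N]addnC addnA subnK // TriD.
rewrite !invrM ?unitrM ?qpoch_unit // exprMn -exprM !exprD.
ring.
Qed.

Lemma has_sum_single a b c : a \is a GRing.unit ->
  fps_has_sum (single_term a b c) (triple_series a b c).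
Proof.
move=> aU n; exists (iota 0 n.+1); split; first exact: iota_uniq.
  move=> i; rewrite mem_iota /= add0n ltnS leqNgt; apply: contra => ltni.
  rewrite /single_term -!mulrA mulrA fcoefMXn_low //.
  by rewrite (leq_trans ltni) ?leq_Tri.
pose G t j := \sum_(l < n.+1) (triple_term a b c (t, val l, j))``_n.
transitivity (\sum_(t < n.+1) \sum_(j < n.+1) G t j).
  rewrite [LHS]big_allpairs big_allpairs -[iota 0 n.+1]/(index_iota 0 n.+1).
  rewrite big_mkord; apply: eq_bigr => t _.
  rewrite exchange_big big_mkord; apply: eq_bigr => j _.
  by rewrite big_mkord.
rewrite -triangular_sum => [|t j lt_n]; last first.
  apply: big1 => l _; apply: fcoef_triple_term.
  by rewrite addnAC ltn_addr.
rewrite -[iota 0 n.+1]/(index_iota 0 n.+1) big_mkord.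
by apply: eq_bigr => i _; rewrite (@fcoef_single_term _ _ _ _ _ n.+1).
Qed.

End QSeries.

(** Ring morphisms preserve the denominators' inverses because each [qpoch q n] is a unit; this
    carries the polynomial series to the fraction field. *)
Lemma map_triple_series (R S : comUnitRingType) (phi : {rmorphism R -> S}) a b c :
  map_fps phi (triple_series a b c) =
  triple_series (map_fps phi a) (map_fps phi b) (map_fps phi c).
Proof.
apply/fpsP => n; rewrite [LHS]rmorph_sum; apply: eq_bigr => -[[t l] j] _.
rewrite -[LHS]/((map_fps phi _)``_n) /triple_term.
rewrite rmorphM rmorphV ?unitrM ?qpoch_unit //.
by rewrite !rmorphM !rmorphXn /= !map_qpoch !map_fpsX.
Qed.

Theorem theorem4p1 (K : idomainType) :
  let F := {fraction {mpoly K[3]}} in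
  let var (i : 'I_3) : {fps F} := fpsC (tofrac ('X_i : {mpoly K[3]})) in
  let a := var (inord 0) in
  let b := var (inord 1) in
  let c := var (inord 2) in
  let q : {fps F} := fpsX in
  exists S : {fps {mpoly K[3]}},
    fps_has_sum
      (fun i : nat =>
         a ^+ i * q ^+ Tri i / qpoch q i
         * qpoch (- (c / a) * q) i * qpoch_inf (- b * q ^+ i.+1))
      (map_fps (@tofrac _) S)
    /\
    fps_has_sum
      (fun tlj : nat * nat * nat =>
         let: (t, l, j) := tlj in
         a ^+ t * b ^+ l * c ^+ j * q ^+ (Tri (t + l + j) + Tri j)
         / (qpoch q t * qpoch q l * qpoch q j))
      (map_fps (@tofrac _) S).
Proof.
move=> F var a b c q.
have aU : a \is a GRing.unit.
  by rewrite fps_unitE unitfE [_ ``_ 0]mulr1n tofrac_eq0 -msupp_eq0 msuppX.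
(* The same series makes sense over the polynomials, as [qpoch q n] has constant
   coefficient [1]. *)
exists (triple_series (fpsC 'X_(inord 0)) (fpsC 'X_(inord 1)) (fpsC 'X_(inord 2))).
rewrite map_triple_series !map_fpsC.
split; first exact: has_sum_single.
exact: has_sum_triple.
Qed.
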